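(* Let $\mathbb{S}$, $\mathbb{T}$ be filtered simplicial complexes with vertex sets $X$, $Y$ respectively, and let $\varepsilon\ge 0$. If $C : X \rightrightarrows Y$ is a correspondence such that $C$ is $\varepsilon$-simplicial from $\mathbb{S}$ to $\mathbb{T}$ and $C^T$ is $\varepsilon$-simplicial from $\mathbb{T}$ to $\mathbb{S}$, then together they induce a canonical $\varepsilon$-interleaving between $\mathrm{H}(\mathbb{S})$ and $\mathrm{H}(\mathbb{T})$, the interleaving homomorphisms being $\mathrm{H}(C)$ and $\mathrm{H}(C^T)$; that is, $\mathrm{H}(C^T)\circ\mathrm{H}(C)=1^{2\varepsilon}_{\mathrm{H}(\mathbb{S})}$ and $\mathrm{H}(C)\circ\mathrm{H}(C^T)=1^{2\varepsilon}_{\mathrm{H}(\mathbb{T})}$.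
   Context: Fix a field $\mathbf{k}$; all vector spaces are over $\mathbf{k}$ and $\mathrm{H}$ denotes (total) simplicial homology with coefficients in $\mathbf{k}$. A persistence module $\mathbb{V}$ is a family of vector spaces $(V_a)_{a\in\mathbf{R}}$ with linear maps $v_a^b:V_a\to V_b$ for $a\le b$ such that $v_a^a=\mathrm{id}$ and $v_b^c\circ v_a^b=v_a^c$ for $a\le b\le c$. For real $\varepsilon$, $\mathrm{Hom}^\varepsilon(\mathbb{U},\mathbb{V})$ is the set of homomorphisms of degree $\varepsilon$, i.e. families of linear maps $(\phi_a:U_a\to V_{a+\varepsilon})_{a\in\mathbf{R}}$ with $v_{a+\varepsilon}^{b+\varepsilon}\circ\phi_a=\phi_b\circ u_a^b$ for all $a\le b$; composition is the obvious one. For $\varepsilon\ge0$, $1_{\mathbb{V}}^\varepsilon\in\mathrm{Hom}^\varepsilon(\mathbb{V},\mathbb{V})$ is the family $(v_a^{a+\varepsilon})_a$. An $\varepsilon$-interleaving between $\mathbb{U}$ and $\mathbb{V}$ is a pair $\Phi\in\mathrm{Hom}^\varepsilon(\mathbb{U},\mathbb{V})$, $\Psi\in\mathrm{Hom}^\varepsilon(\mathbb{V},\mathbb{U})$ with $\Psi\Phi=1_{\mathbb{U}}^{2\varepsilon}$ and $\Phi\Psi=1_{\mathbb{V}}^{2\varepsilon}$. A filtered simplicial complex $\mathbb{S}$ with vertex set $X$ is a family $(\mathbb{S}_a)_{a\in\mathbf{R}}$ of subcomplexes of a fixed simplicial complex on the vertex set $X$ with $\mathbb{S}_a\subseteq\mathbb{S}_b$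 whenever $a\le b$ (simplices are nonempty finite subsets of $X$). $\mathrm{H}(\mathbb{S})$ is the persistence module $(\mathrm{H}(\mathbb{S}_a))_a$ with maps induced by inclusions. A multivalued map $C:X\rightrightarrows Y$ is a subset $C\subseteq X\times Y$ that projects surjectively onto $X$. For $\sigma\subseteq X$, $C(\sigma)=\{y\in Y: \exists x\in\sigma,\ (x,y)\in C\}$. The transpose is $C^T=\{(y,x):(x,y)\in C\}$. $C$ is a correspondence if it also projects surjectively onto $Y$ (equivalently $C^T:Y\rightrightarrows X$ is a multivalued map). A map $f:X\to Y$ is subordinate to $C$ if $(x,f(x))\in C$ for every $x\in X$. $C$ is $\varepsilon$-simplicial from $\mathbb{S}$ to $\mathbb{T}$ if for every $a\in\mathbf{R}$ and every simplex $\sigma\in\mathbb{S}_a$, every (nonempty) finite subset of $C(\sigma)$ is a simplex of $\mathbb{T}_{a+\varepsilon}$. In that case $\mathrm{H}(C)\in\mathrm{Hom}^\varepsilon(\mathrm{H}(\mathbb{S}),\mathrm{H}(\mathbb{T}))$ denotes the homomorphism $\mathrm{H}(f)$ induced by the simplicial maps $f:\mathbb{S}_a\to\mathbb{T}_{a+\varepsilon}$, for any $f:X\to Y$ subordinate to $C$; it does not depend on the choice of $f$. *)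

(* Defs.v *)
From HB Require Import structures.
From mathcomp Require Import all_boot all_order all_algebra.
From mathcomp Require Import finmap generic_quotient ring_quotient freeg.
From mathcomp Require Import boolp classical_sets reals.

Set Implicit Arguments.
Unset Strict Implicit.
Unset Printing Implicit Defensive.

Import Order.TTheory GRing.Theory Num.Theory.
Local Open Scope classical_set_scope.
Local Open Scope ring_scope.

Section Subspaces.
Context {k : fieldType} {V : lmodType k}.

Definition subspace_axiom (P : set V) : Prop :=
  P 0 /\ forall (a : k) x y, P x -> P y -> P (a *: x + y).

Definition mem_of (P : set V) (hP : subspace_axiom P) : V -> bool :=
  fun x => `[< P x >].

Lemma mem_of_submod_closed P (hP : subspace_axiom P) : submod_closed (mem_of hP).
Proof.
split=> [|a x y /asboolP hx /asboolP hy]; apply/asboolP; first exact: hP.1.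
exact: hP.2.
Qed.

HB.instance Definition _ P (hP : subspace_axiom P) :=
  GRing.isSubmodClosed.Build k V (mem_of hP) (mem_of_submod_closed hP).

Definition subspace P (hP : subspace_axiom P) :=
  GRing.SubmodClosed.clone k V (mem_of hP) _.

Lemma subspaceP P (hP : subspace_axiom P) x : reflect (P x) (x \in subspace hP).
Proof. exact: asboolP. Qed.

Lemma span_subspace (G : set V) : subspace_axiom
  [set x | forall W : submodClosed V, (forall g, G g -> g \in W) -> x \in W].
Proof.
split=> [W _|a x y hx hy W hW]; first exact: rpred0.
by rewrite rpredD ?rpredZ ?hx ?hy.
Qed.

Definition span (G : set V) : submodClosed V := subspace (span_subspace G).

Lemma mem_span G g : G g -> g \in span G.
Proof. by move=> Gg; apply/subspaceP => W; apply. Qed.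

Lemma span_ind G (W : submodClosed V) :
  (forall g, G g -> g \in W) -> {subset span G <= W}.
Proof. by move=> hW x /subspaceP; apply. Qed.

End Subspaces.

Arguments subspace : simpl never.
Arguments span : simpl never.

Section Kernel.
Context {k : fieldType} {V V' : lmodType k}.

Lemma preim_subspace (f : {linear V -> V'}) (W : submodClosed V') :
  subspace_axiom [set x | f x \in W].
Proof.
split=> [|a x y /= hx hy] /=; first by rewrite linear0 rpred0.
by rewrite linearP rpredD ?rpredZ.
Qed.

Lemma span_preim (G : set V) (f : {linear V -> V'}) (W : submodClosed V') :
  (forall x, G x -> f x \in W) -> {in span G, forall x, f x \in W}.
Proof.
move=> h x xG; apply/(subspaceP (preim_subspace f W)).
by apply: (span_ind _ xG) => y Gy; apply/subspaceP/h.
Qed.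

Lemma ker_subspace (f : {linear V -> V'}) : subspace_axiom [set x | f x = 0].
Proof.
split=> [|a x y /= hx hy] /=; first by rewrite linear0.
by rewrite linearP hx hy scaler0 addr0.
Qed.

Lemma span_eq (G : set V) (f g : {linear V -> V'}) :
  (forall x, G x -> f x = g x) -> {in span G, f =1 g}.
Proof.
move=> h x xG; apply/eqP; rewrite -subr_eq0.
apply/eqP/(subspaceP (ker_subspace (f \- g))).
by apply: (span_ind _ xG) => y Gy; apply/subspaceP; rewrite /= h ?subrr.
Qed.

End Kernel.

Section SubQuot.
Context {k : fieldType} {V : lmodType k}.
Implicit Type W : submodClosed V.

Definition subsp W : Type := {x : V | x \in W}.

HB.instance Definition _ W := SubChoice.on (subsp W).
HB.instance Definition _ W := [SubChoice_isSubLmodule of subsp W by <:].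

Definition mem_submod W : V -> bool := fun x => x \in W.

Lemma mem_submod_zmod_closed W : zmod_closed (mem_submod W).
Proof. exact: GRing.submod_closedB (GRing.submodClosedP W). Qed.

HB.instance Definition _ W :=
  GRing.isZmodClosed.Build V (mem_submod W) (mem_submod_zmod_closed W).

Definition zmod_of W := GRing.ZmodClosed.clone V (mem_submod W) _.

Definition quotsp W : Type := Quotient.quot (zmod_of W).

HB.instance Definition _ W := GRing.Zmodule.on (quotsp W).

Definition qpi W : V -> quotsp W := \pi_(Quotient.quot (zmod_of W))%qT.
Definition qrepr W : quotsp W -> V := fun x => repr (x : Quotient.quot (zmod_of W)).

Lemma qreprK W : cancel (@qrepr W) (@qpi W).
Proof. exact: reprK. Qed.

Lemma qpi_eq W x y : (qpi W x == qpi W y) = (x - y \in W).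
Proof. exact/esym/(Quotient.idealrBE (zmod_of W)). Qed.

Lemma qpi_zmod_morphism W : zmod_morphism (qpi W).
Proof. exact: (@raddfB _ _ (\pi_(Quotient.quot (zmod_of W)))%qT). Qed.

HB.instance Definition _ W :=
  GRing.isZmodMorphism.Build V (quotsp W) (qpi W) (qpi_zmod_morphism W).

Definition qscale W (a : k) (x : quotsp W) : quotsp W := qpi W (a *: qrepr x).

Lemma qpiZ W a x : qpi W (a *: x) = qscale a (qpi W x).
Proof.
apply/eqP; rewrite qpi_eq -scalerBr rpredZ // -qpi_eq.
by rewrite qreprK.
Qed.

Lemma qscaleA W a b (x : quotsp W) : qscale a (qscale b x) = qscale (a * b) x.
Proof. by rewrite -(qreprK x) -!qpiZ scalerA. Qed.
Lemma qscale1 W : left_id 1 (@qscale W).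
Proof. by move=> x; rewrite -(qreprK x) -qpiZ scale1r. Qed.
Lemma qscaleDr W : right_distributive (@qscale W) +%R.
Proof.
move=> a x y; rewrite -(qreprK x) -(qreprK y) -raddfD -!qpiZ -raddfD.
by rewrite scalerDr.
Qed.
Lemma qscaleDl W (x : quotsp W) : {morph (@qscale W)^~ x : a b / a + b}.
Proof. by move=> a b; rewrite -(qreprK x) -!qpiZ -raddfD scalerDl. Qed.

HB.instance Definition _ W := GRing.Zmodule_isLmodule.Build k (quotsp W)
  (@qscaleA W) (@qscale1 W) (@qscaleDr W) (@qscaleDl W).

Lemma qpi_scalable W : scalable (qpi W).
Proof. exact: qpiZ. Qed.

HB.instance Definition _ W :=
  GRing.isScalable.Build k V (quotsp W) *:%R (qpi W) (@qpi_scalable W).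

Lemma qpi_eq0 W x : (qpi W x == 0) = (x \in W).
Proof. by rewrite -(linear0 (qpi W)) qpi_eq subr0. Qed.

Lemma quotsp_ind W (P : quotsp W -> Prop) :
  (forall x, P (qpi W x)) -> forall q, P q.
Proof. by move=> h q; rewrite -(qreprK q). Qed.

End SubQuot.

Section Factor.
Context {k : fieldType} {V U : lmodType k} (W : submodClosed V).

Definition qfactor (f : {linear V -> U}) of {in W, forall x, f x = 0} :=
  fun q : quotsp W => f (qrepr q).

Context (f : {linear V -> U}) (fW : {in W, forall x, f x = 0}).

Lemma qfactorE x : qfactor fW (qpi W x) = f x.
Proof. by apply/eqP; rewrite -subr_eq0 -linearB fW // -qpi_eq qreprK. Qed.

Lemma qfactor_linear : linear (qfactor fW).
Proof.
move=> a x y; rewrite -(qreprK x) -(qreprK y).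
by rewrite -linearP !qfactorE linearP.
Qed.

HB.instance Definition _ :=
  GRing.isLinear.Build k (quotsp W) U *:%R (qfactor fW) qfactor_linear.

End Factor.

Section Restrict.
Context {k : fieldType} {V V' : lmodType k}.
Context (W : submodClosed V) (W' : submodClosed V').
Context (f : {linear V -> V'}) (fW : {in W, forall x, f x \in W'}).

Definition srestr (x : subsp W) : subsp W' := exist _ (f (val x)) (fW (valP x)).

Lemma srestr_linear : linear srestr.
Proof. by move=> a x y; apply/val_inj; rewrite /= linearP. Qed.

HB.instance Definition _ :=
  GRing.isLinear.Build k (subsp W) (subsp W') *:%R srestr srestr_linear.

End Restrict.

Section FreeLift.
Context {k : fieldType} {K : choiceType}.

Lemma freeg_linear_ext {U : lmodType k} (f g : {linear {freeg K / k} -> U}) :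
  (forall x, f << x >> = g << x >>) -> f =1 g.
Proof.
move=> h D; elim/freeg_ind_dom0: D => [|a x D _ _ IH]; first by rewrite !linear0.
rewrite !linearD IH.
suff -> : << a *g x >> = a *: << x >> :> {freeg K / k} by rewrite !linearZ h.
by apply/eqP/freeg_eqP => y; rewrite coeffZ !coeffU mul1r.
Qed.

Context {U : lmodType k} (phi : K -> U).

Lemma fglift_linear : linear (fglift phi : {freeg K / k} -> U).
Proof.
move=> a x y; rewrite -[y in LHS]opprK lift_is_additive.
have fglift0 : fglift phi 0 = 0.
  by rewrite -(subrr (0 : {freeg K / k})) lift_is_additive subrr.
have fgliftN z : fglift phi (- z) = - fglift phi z.
  by rewrite -(add0r (- z)) lift_is_additive fglift0 sub0r.
rewrite fgliftN opprK; congr (_ + _).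
have fgliftD z t : fglift phi (z + t) = fglift phi z + fglift phi t.
  by rewrite -[t in LHS]opprK lift_is_additive fgliftN opprK.
elim/freeg_ind_dom0: x => [|b z D _ _ IH]; first by rewrite scaler0 fglift0 scaler0.
rewrite scalerDr !fgliftD IH scalerDr; congr (_ + _).
suff -> : a *: << b *g z >> = << a * b *g z >> :> {freeg K / k}.
  by rewrite !liftU scalerA.
by apply/eqP/freeg_eqP => t; rewrite coeffZ !coeffU mulrA.
Qed.

Definition free_lift : {freeg K / k} -> U := fglift phi.

HB.instance Definition _ :=
  GRing.isLinear.Build k {freeg K / k} U *:%R free_lift fglift_linear.

Lemma free_liftE x : free_lift << x >> = phi x.
Proof. by rewrite [LHS]liftU scale1r. Qed.

End FreeLift.

Section Chains.
Context (k : fieldType) (X : choiceType).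

(* Oriented chains on the vertex set X, all degrees together: the free vector
   space on ordered simplices [x_0, ..., x_n] (a sequence of length n + 1 is in
   degree n), modulo degenerate simplices and modulo the relation that exchanging
   two vertices changes the sign.  The empty sequence also has a class here, but
   it never occurs in the chains of a complex. *)
Inductive orient_rel : {freeg (seq X) / k} -> Prop :=
| OrientDegen s : ~~ uniq s -> orient_rel << s >>
| OrientSwap s1 x y s2 :
    orient_rel (<< s1 ++ x :: y :: s2 >> + << s1 ++ y :: x :: s2 >>).

Definition Chain : Type := quotsp (span orient_rel).

HB.instance Definition _ := GRing.Lmodule.on Chain.

Definition osimp (s : seq X) : Chain := qpi (span orient_rel) << s >>.

Lemma osimp_degen s : ~~ uniq s -> osimp s = 0.
Proof. by move=> us; apply/eqP; rewrite qpi_eq0 mem_span //; constructor. Qed.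

Lemma osimp_swap s1 x y s2 :
  osimp (s1 ++ x :: y :: s2) = - osimp (s1 ++ y :: x :: s2).
Proof.
apply/eqP; rewrite -addr_eq0 -linearD qpi_eq0.
by apply: mem_span; constructor.
Qed.

Section ChainLift.
Context {U : lmodType k} (phi : seq X -> U).
Context (phi_degen : forall s, ~~ uniq s -> phi s = 0).
Context (phi_swap : forall s1 x y s2,
  phi (s1 ++ x :: y :: s2) = - phi (s1 ++ y :: x :: s2)).

Lemma free_lift_orient : {in span orient_rel, forall c, free_lift phi c = 0}.
Proof.
move=> c cR; apply: (span_eq (g := \0) _ cR) => _ [s us|s1 x y s2].
  by rewrite /= free_liftE phi_degen.
by rewrite linearD /= !free_liftE phi_swap addNr.
Qed.

Definition chain_lift : Chain -> U := qfactor free_lift_orient.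

HB.instance Definition _ := GRing.Linear.on chain_lift.

Lemma chain_liftE s : chain_lift (osimp s) = phi s.
Proof. by rewrite -(free_liftE phi) -(qfactorE free_lift_orient). Qed.

End ChainLift.

Lemma chain_ext {U : lmodType k} (f g : {linear Chain -> U}) :
  (forall s, f (osimp s) = g (osimp s)) -> f =1 g.
Proof.
move=> h c; rewrite -(qreprK c).
exact: (freeg_linear_ext (f := f \o qpi _) (g := g \o qpi _) h).
Qed.

Section Cone.
Variable x : X.

Lemma cone_degen s : ~~ uniq s -> osimp (x :: s) = 0.
Proof. by move=> us; apply: osimp_degen; rewrite /= (negPf us) andbF. Qed.

Lemma cone_swap s1 y z s2 :
  osimp (x :: s1 ++ y :: z :: s2) = - osimp (x :: s1 ++ z :: y :: s2).
Proof. exact: (osimp_swap (x :: s1)). Qed.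

Definition cone : Chain -> Chain := chain_lift cone_degen cone_swap.

HB.instance Definition _ := GRing.Linear.on cone.

Lemma coneE s : cone (osimp s) = osimp (x :: s).
Proof. exact: chain_liftE. Qed.

End Cone.

Lemma coneC x y c : cone x (cone y c) = - cone y (cone x c).
Proof.
apply: (chain_ext (f := cone x \o cone y) (g := \- (cone y \o cone x))) => s /=.
by rewrite !coneE (osimp_swap [::]).
Qed.

Lemma cone2 x c : cone x (cone x c) = 0.
Proof.
apply: (chain_ext (f := cone x \o cone x) (g := \0)) => s /=.
by rewrite !coneE osimp_degen //= inE eqxx.
Qed.

Definition face (i : nat) (s : seq X) : seq X := take i s ++ drop i.+1 s.

Definition faces (s : seq X) : Chain :=
  \sum_(i < size s) (-1) ^+ i *: osimp (face i s).

Lemma faces_cons x s : faces (x :: s) = osimp s - cone x (faces s).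
Proof.
rewrite /faces big_ord_recl /= expr0 scale1r {1}/face /= drop0; congr (_ + _).
rewrite linear_sum -sumrN; apply: eq_bigr => i _.
by rewrite linearZ /= coneE /face /= exprS mulN1r scaleNr.
Qed.

Lemma faces_swap s1 x y s2 :
  faces (s1 ++ x :: y :: s2) = - faces (s1 ++ y :: x :: s2).
Proof.
elim: s1 => [|z s1 IH] /=.
  rewrite !faces_cons !linearB /= !coneE coneC.
  by rewrite !opprK addrCA.
by rewrite !faces_cons IH osimp_swap linearN opprB opprK addrC.
Qed.

Lemma cone_faces x s : x \in s -> cone x (faces s) = osimp s.
Proof.
elim: s => // y s IH; rewrite inE faces_cons linearB /= coneE.
have [->|_ /= xs] := eqVneq x y; first by rewrite cone2 subr0.
by rewrite coneC opprK IH // coneE osimp_degen ?add0r //= xs.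
Qed.

Lemma faces_degen s : ~~ uniq s -> faces s = 0.
Proof.
elim: s => //= x s IH; rewrite negb_and negbK faces_cons => /orP[xs|us].
  by rewrite cone_faces // subrr.
by rewrite IH // linear0 subr0 osimp_degen.
Qed.

(* The condition [1 < size s] makes the boundary of a vertex 0, rather than the
   class of the empty sequence, so that homology is not reduced. *)
Definition bd_osimp (s : seq X) : Chain :=
  \sum_(i < size s | (1 < size s)%N) (-1) ^+ i *: osimp (face i s).

Lemma bd_osimpE s : bd_osimp s = if (1 < size s)%N then faces s else 0.
Proof. by rewrite /bd_osimp; case: ifP => hs; [apply: eq_bigl | rewrite big_pred0]. Qed.

Lemma bd_osimp_degen s : ~~ uniq s -> bd_osimp s = 0.
Proof. by move=> us; rewrite bd_osimpE faces_degen ?if_same. Qed.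

Lemma bd_osimp_swap s1 x y s2 :
  bd_osimp (s1 ++ x :: y :: s2) = - bd_osimp (s1 ++ y :: x :: s2).
Proof. by rewrite !bd_osimpE faces_swap !size_cat /= !addnS. Qed.

Definition bd : Chain -> Chain := chain_lift bd_osimp_degen bd_osimp_swap.

HB.instance Definition _ := GRing.Linear.on bd.

Lemma bdE s : bd (osimp s) = bd_osimp s.
Proof. exact: chain_liftE. Qed.

Definition aug : Chain -> Chain := chain_lift faces_degen faces_swap.

HB.instance Definition _ := GRing.Linear.on aug.

Lemma augE s : aug (osimp s) = faces s.
Proof. exact: chain_liftE. Qed.

Lemma aug_cone x c : aug (cone x c) = c - cone x (aug c).
Proof.
apply: (chain_ext (f := aug \o cone x) (g := idfun \- (cone x \o aug))) => s /=.
by rewrite coneE !augE faces_cons.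
Qed.

Lemma aug_aug c : aug (aug c) = 0.
Proof.
apply: (chain_ext (f := aug \o aug) (g := \0)) => s /=.
rewrite augE; elim: s => [|x s IH]; first by rewrite /faces big_ord0 linear0.
by rewrite faces_cons linearB /= aug_cone augE IH linear0 subr0 subrr.
Qed.

Lemma size_face i s : (i < size s)%N -> size (face i s) = (size s).-1.
Proof.
move=> hi; rewrite size_cat size_take size_drop hi.
by rewrite subnS -subn1 addnBA ?subn_gt0 // subnKC ?subn1 // ltnW.
Qed.

Theorem bd_bd c : bd (bd c) = 0.
Proof.
apply: (chain_ext (f := bd \o bd) (g := \0)) => s /=.
rewrite bdE bd_osimpE; case: ifP => hs; last by rewrite linear0.
have -> : bd (faces s) = if (2 < size s)%N then aug (faces s) else 0.
  case: ifP => hs2; rewrite !linear_sum /=.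
    apply: eq_bigr => i _; rewrite !linearZ /= bdE augE bd_osimpE size_face //.
    by rewrite -ltnS prednK ?(ltnW hs) // hs2.
  apply: big1 => i _; rewrite linearZ /= bdE bd_osimpE size_face //.
  by rewrite -ltnS prednK ?(ltnW hs) // hs2 scaler0.
by rewrite -augE aug_aug if_same.
Qed.

End Chains.

Arguments osimp k {X} s.
Arguments bd {k X} c.

Section Push.
Context (k : fieldType) (X Y : choiceType) (f : X -> Y).

Definition push_osimp (s : seq X) : Chain k Y := osimp k (map f s).

Lemma push_osimp_degen s : ~~ uniq s -> push_osimp s = 0.
Proof. by move=> us; apply: osimp_degen; apply: contra us => /map_uniq. Qed.

Lemma push_osimp_swap s1 x y s2 :
  push_osimp (s1 ++ x :: y :: s2) = - push_osimp (s1 ++ y :: x :: s2).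
Proof. by rewrite /push_osimp !map_cat /= osimp_swap. Qed.

Definition push : Chain k X -> Chain k Y :=
  chain_lift push_osimp_degen push_osimp_swap.

HB.instance Definition _ := GRing.Linear.on push.

Lemma pushE s : push (osimp k s) = osimp k (map f s).
Proof. exact: chain_liftE. Qed.

Lemma push_bd c : push (bd c) = bd (push c).
Proof.
apply: (chain_ext (f := push \o bd) (g := bd \o push)) => s /=.
rewrite pushE !bdE !bd_osimpE size_map; case: ifP => _; last by rewrite linear0.
rewrite /faces size_map linear_sum; apply: eq_bigr => i _.
by rewrite linearZ /= pushE /face map_cat map_take map_drop.
Qed.

End Push.

Arguments push k {X Y} f c.

Lemma push_id (k : fieldType) (X : choiceType) c : push k (@id X) c = c.
Proof.
apply: (chain_ext (f := push k (@id X)) (g := idfun)) => s /=.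
by rewrite pushE map_id.
Qed.

Lemma push_comp (k : fieldType) (X Y Z : choiceType) (f : X -> Y) (g : Y -> Z) c :
  push k g (push k f c) = push k (g \o f) c.
Proof.
apply: (chain_ext (f := push k g \o push k f) (g := push k (g \o f))) => s /=.
by rewrite !pushE -map_comp.
Qed.

Record complex (X : choiceType) := Complex {
  simplices :> {fset X} -> Prop;
  simplex_neq0 : forall sigma, simplices sigma -> sigma != fset0%fset;
  simplex_sub : forall sigma tau, simplices sigma ->
    (tau `<=` sigma)%fset -> tau != fset0%fset -> simplices tau }.

Definition simplicial (X Y : choiceType) (K : complex X) (L : complex Y)
    (f : X -> Y) : Prop :=
  forall sigma : {fset X}, K sigma -> L [fset f x | x in sigma]%fset.

Lemma simplicial_comp (X Y Z : choiceType) (K : complex X) (L : complex Y)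
    (M : complex Z) (f : X -> Y) (g : Y -> Z) :
  simplicial K L f -> simplicial L M g -> simplicial K M (g \o f).
Proof.
move=> hf hg sigma /hf/hg; congr (simplices M _); apply/fsetP => z.
apply/imfsetP/imfsetP => [[_ /imfsetP[x /= xs ->] ->]|[x /= xs ->]].
  by exists x.
by exists (f x) => //; apply/imfsetP; exists x.
Qed.

Section Homology.
Context (k : fieldType) (X : choiceType) (K : complex X).

(* Since chains of all degrees are taken together, [homology] below is the total
   homology, the direct sum of the homology spaces in each degree. *)
Definition chains : submodClosed (Chain k X) :=
  span [set osimp k s | s in [set s | K [fset x | x in s]%fset]].

Lemma cycles_subspace :
  subspace_axiom [set c | c \in chains /\ bd c = 0].
Proof.
split=> [|a c d /= [cK c0] [dK d0]] /=; first by rewrite rpred0 linear0.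
by rewrite rpredD ?rpredZ // linearP /= c0 d0 scaler0 addr0.
Qed.

Definition cycles : submodClosed (Chain k X) := subspace cycles_subspace.

Lemma boundaries_subspace :
  subspace_axiom [set z : subsp cycles | exists2 d, d \in chains & bd d = val z].
Proof.
split=> [|a y z /= [c cK cy] [d dK dz]] /=.
  by exists 0; rewrite ?rpred0 ?linear0.
by exists (a *: c + d); rewrite ?rpredD ?rpredZ // linearP /= cy dz.
Qed.

Definition boundaries : submodClosed (subsp cycles) := subspace boundaries_subspace.

Definition homology : Type := quotsp boundaries.

HB.instance Definition _ := GRing.Lmodule.on homology.

Definition hclass : subsp cycles -> homology := qpi boundaries.

HB.instance Definition _ := GRing.Linear.on hclass.

End Homology.

Section HomologyMap.
Context (k : fieldType) (X Y : choiceType) (K : complex X) (L : complex Y).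
Context (f : X -> Y) (fKL : simplicial K L f).

Lemma push_chains : {in chains k K, forall c, push k f c \in chains k L}.
Proof.
apply: span_preim => _ [s sK <-]; rewrite /= pushE.
apply: mem_span; exists (map f s) => //=; move/fKL: sK.
congr (simplices L _); apply/fsetP => y.
apply/imfsetP/imfsetP => /= [[_ /imfsetP[x /= xs ->] ->]|[_ /mapP[x xs ->] ->]].
  by exists (f x) => //; apply: map_f.
by exists x => //; apply/imfsetP; exists x.
Qed.

Lemma push_cycles : {in cycles k K, forall c, push k f c \in cycles k L}.
Proof.
move=> c /subspaceP[cK c0]; apply/subspaceP; split; first exact: push_chains.
by rewrite -push_bd c0 linear0.
Qed.

Definition push_cycle : subsp (cycles k K) -> subsp (cycles k L) :=
  srestr push_cycles.

HB.instance Definition _ := GRing.Linear.on push_cycle.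

Definition push_hclass : subsp (cycles k K) -> homology k L :=
  @hclass k Y L \o push_cycle.

HB.instance Definition _ := GRing.Linear.on push_hclass.

Lemma push_hclass_boundary : {in boundaries k K, forall z, push_hclass z = 0}.
Proof.
move=> z /subspaceP[d dK dz]; apply/eqP; rewrite qpi_eq0; apply/subspaceP.
by exists (push k f d); [exact: push_chains | rewrite -push_bd dz].
Qed.

Definition homology_map : homology k K -> homology k L :=
  qfactor push_hclass_boundary.

HB.instance Definition _ := GRing.Linear.on homology_map.

Lemma homology_mapE z : homology_map (hclass z) = hclass (push_cycle z).
Proof. exact: qfactorE. Qed.

End HomologyMap.

Arguments homology_map k {X Y K L f} fKL h.

Section Functoriality.
Context (k : fieldType).

Lemma homology_ind (X : choiceType) (K : complex X) (P : homology k K -> Prop) :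
  (forall z, P (hclass z)) -> forall h, P h.
Proof. exact: quotsp_ind. Qed.

Lemma homology_map_id (X : choiceType) (K : complex X) (h : simplicial K K id) :
  homology_map k h =1 id.
Proof.
elim/homology_ind => z; rewrite homology_mapE; congr hclass.
by apply/val_inj; rewrite /= push_id.
Qed.

Lemma homology_map_comp (X Y Z : choiceType) (K : complex X) (L : complex Y)
    (M : complex Z) (f : X -> Y) (g : Y -> Z) (hf : simplicial K L f)
    (hg : simplicial L M g) (hgf : simplicial K M (g \o f)) x :
  homology_map k hg (homology_map k hf x) = homology_map k hgf x.
Proof.
elim/homology_ind: x => z; rewrite !homology_mapE; congr hclass.
by apply/val_inj; rewrite /= push_comp.
Qed.

End Functoriality.

Record pmodule (R : realType) (k : fieldType) := PModule {
  pspace :> R -> lmodType k;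
  ptrans : forall a b : R, a <= b -> {linear pspace a -> pspace b};
  ptrans_id : forall a (aa : a <= a) v, ptrans aa v = v;
  ptrans_comp : forall a b c (ab : a <= b) (bc : b <= c) (ac : a <= c) v,
    ptrans bc (ptrans ab v) = ptrans ac v }.

Record phom (R : realType) (k : fieldType) (eps : R) (U V : pmodule R k) := PHom {
  phom_map :> forall a : R, {linear U a -> V (a + eps)};
  phom_natural : forall a b (ab : a <= b) (ab' : a + eps <= b + eps) u,
    ptrans V ab' (phom_map a u) = phom_map b (ptrans U ab u) }.

Section PersistenceHom.
Context {R : realType} {k : fieldType}.
Implicit Types (U V W : pmodule R k).

Lemma phom_ext eps U V (F G : phom eps U V) :
  (forall a u, F a u = G a u) -> F = G.
Proof.
case: F G => [F hF] [G hG] /= FG.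
have eqFG : F = G.
  apply: functional_extensionality_dep => a.
  have : (F a : U a -> V (a + eps)) = G a by apply/funext/FG.
  case: (F a) (G a) => [f [[fN] [fZ]]] [g [[gN] [gZ]]] /= fg; subst g.
  by rewrite (Prop_irrelevance fN gN) (Prop_irrelevance fZ gZ).
by subst G; congr PHom; exact: Prop_irrelevance.
Qed.

Section Composition.
Context (delta eps : R) (U V W : pmodule R k).
Context (G : phom delta V W) (F : phom eps U V).

Lemma shift_assoc (a : R) : a + eps + delta <= a + (eps + delta).
Proof. by rewrite addrA. Qed.

(* [a + eps + delta] and [a + (eps + delta)] are equal but not convertible;
   the structure map of [W] between these indices is the identification. *)
Definition phom_comp_map a : {linear U a -> W (a + (eps + delta))} :=
  ptrans W (shift_assoc a) \o (G (a + eps) \o F a).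

Lemma phom_comp_natural a b (ab : a <= b)
    (ab' : a + (eps + delta) <= b + (eps + delta)) u :
  ptrans W ab' (phom_comp_map a u) = phom_comp_map b (ptrans U ab u).
Proof.
have ab1 : a + eps <= b + eps by rewrite lerD2r.
have ab2 : a + eps + delta <= b + eps + delta by rewrite lerD2r.
have ac : a + eps + delta <= b + (eps + delta) by rewrite addrA.
rewrite /= (ptrans_comp _ _ ac) -(phom_natural F ab ab1) -(phom_natural G ab1 ab2).
by rewrite (ptrans_comp _ _ ac).
Qed.

Definition phom_comp : phom (eps + delta) U W := PHom phom_comp_natural.

End Composition.

Section Shift.
Context (V : pmodule R k) (eps : R) (eps_ge0 : 0 <= eps).

Lemma shift_le (a : R) : a <= a + eps.
Proof. by rewrite lerDl. Qed.

Lemma pshift_natural a b (ab : a <= b) (ab' : a + eps <= b + eps) v :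
  ptrans V ab' (ptrans V (shift_le a) v) = ptrans V (shift_le b) (ptrans V ab v).
Proof.
have ac : a <= b + eps by apply: le_trans ab (shift_le b).
by rewrite !(ptrans_comp _ _ ac).
Qed.

Definition pshift : phom eps V V :=
  @PHom R k eps V V (fun a => ptrans V (shift_le a)) pshift_natural.

End Shift.

Definition interleaving (eps : R) (eps_ge0 : 0 <= eps) U V
    (F : phom eps U V) (G : phom eps V U) : Prop :=
  phom_comp G F = pshift U (mulrn_wge0 2 eps_ge0) /\
  phom_comp F G = pshift V (mulrn_wge0 2 eps_ge0).

End PersistenceHom.

(* The ambient complex is not required to contain every point of X as a vertex;
   it can always be enlarged to do so. *)
Record filtered_complex (R : realType) (X : choiceType) := FilteredComplex {
  ambient : complex X;
  level :> R -> complex X;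
  level_ambient : forall a sigma, level a sigma -> ambient sigma;
  level_mono : forall a b sigma, a <= b -> level a sigma -> level b sigma }.

Section PersistentHomology.
Context {R : realType} (k : fieldType).

Section Module.
Context {X : choiceType} (S : filtered_complex R X).

Lemma simplicial_incl a b : a <= b -> simplicial (S a) (S b) id.
Proof.
move=> ab sigma; rewrite imfset_id; exact: level_mono.
Qed.

Arguments simplicial_incl {a b} ab.

Lemma incl_id a (aa : a <= a) v : homology_map k (simplicial_incl aa) v = v.
Proof. exact: homology_map_id. Qed.

Lemma incl_comp a b c (ab : a <= b) (bc : b <= c) (ac : a <= c) v :
  homology_map k (simplicial_incl bc) (homology_map k (simplicial_incl ab) v) =
  homology_map k (simplicial_incl ac) v.
Proof. exact: homology_map_comp. Qed.

Definition phomology : pmodule R k :=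
  @PModule R k (fun a => homology k (S a))
    (fun a b ab => homology_map k (simplicial_incl ab)) incl_id incl_comp.

End Module.

Arguments simplicial_incl {X} S {a b} ab.

Section Map.
Context {X Y : choiceType} {S : filtered_complex R X} {T : filtered_complex R Y}.
Context {eps : R} {f : X -> Y} (hf : forall a, simplicial (S a) (T (a + eps)) f).

Lemma phomology_map_natural a b (ab : a <= b) (ab' : a + eps <= b + eps)
    (u : phomology S a) :
  ptrans (phomology T) ab' (homology_map k (@hf a) u) =
  homology_map k (@hf b) (ptrans (phomology S) ab u).
Proof.
have h : simplicial (S a) (T (b + eps)) f :=
  @simplicial_comp _ _ _ _ _ _ f id (@hf a) (simplicial_incl T ab').
transitivity (homology_map k h u); first exact: homology_map_comp.
by apply/esym; exact: homology_map_comp.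
Qed.

Definition phomology_map : phom eps (phomology S) (phomology T) :=
  @PHom R k eps (phomology S) (phomology T)
    (fun a => homology_map k (@hf a)) phomology_map_natural.

End Map.

End PersistentHomology.

Definition transpose {X Y : Type} (C : set (X * Y)) : set (Y * X) :=
  [set p | C (p.2, p.1)].

Definition multivalued {X Y : Type} (C : set (X * Y)) : Prop :=
  forall x, exists y, C (x, y).

Definition correspondence {X Y : Type} (C : set (X * Y)) : Prop :=
  multivalued C /\ multivalued (transpose C).

Section Multivalued.
Context {X Y : choiceType}.
Implicit Types (C : set (X * Y)) (f : X -> Y).

Definition mimage C (sigma : set X) : set Y :=
  [set y | exists2 x, sigma x & C (x, y)].

Definition subordinate f C : Prop := forall x, C (x, f x).

Definition eps_simplicial {R : realType} (eps : R) (S : filtered_complex R X)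
    (T : filtered_complex R Y) C : Prop :=
  forall a (sigma : {fset X}) (tau : {fset Y}), S a sigma ->
    tau != fset0%fset -> [set` tau] `<=` mimage C [set` sigma] -> T (a + eps) tau.

Lemma subordinate_exists C : multivalued C -> exists f, subordinate f C.
Proof. by move=> hC; have [f hf] := boolp.choice hC; exists f. Qed.

Lemma subordinate_simplicial {R : realType} (eps : R) (S : filtered_complex R X)
    (T : filtered_complex R Y) C f :
  eps_simplicial eps S T C -> subordinate f C ->
  forall a, simplicial (S a) (T (a + eps)) f.
Proof.
move=> hC hf a sigma sS; apply: (hC a sigma) => //.
  have /fset0Pn[x xs] := simplex_neq0 sS; apply/fset0Pn; exists (f x).
  by apply/imfsetP; exists x.
by move=> _ /imfsetP[x /= xs ->]; exists x.
Qed.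

End Multivalued.

Section HomologyMultivalued.
Context {R : realType} (k : fieldType) {X Y : choiceType}.
Context {S : filtered_complex R X} {T : filtered_complex R Y} {eps : R}.
Context {C : set (X * Y)} (hC : multivalued C) (sC : eps_simplicial eps S T C).

(* H(C) is defined through one chosen map subordinate to C. *)
Definition selection : X -> Y := sval (cid (subordinate_exists hC)).

Lemma selection_subordinate : subordinate selection C.
Proof. exact: proj2_sig (cid (subordinate_exists hC)). Qed.

Definition phomology_multi : phom eps (phomology k S) (phomology k T) :=
  phomology_map k (subordinate_simplicial sC selection_subordinate).

End HomologyMultivalued.

(* Main.v *)
Require Import Defs.
From HB Require Import structures.
From mathcomp Require Import all_boot all_order all_algebra.
From mathcomp Require Import finmap boolp classical_sets reals.

Import GRing.Theory.

Local Open Scope classical_set_scope.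
Local Open Scope ring_scope.

(** Any two maps subordinate to an [eps]-simplicial multivalued map send each
    simplex into one common simplex: they are contiguous.  Contiguous maps induce
    the same map in homology ([contiguous_homology_map]), hence [H(C)] does not
    depend on the subordinate map.  If moreover [f] is subordinate to [C] and [g]
    to its transpose, then both [x] and [g (f x)] are related to [f x]; so for a
    simplex [sigma] the points of [sigma] and of [g (f sigma)] together span a
    simplex, [g \o f] is contiguous to the inclusion, and the composite in
    homology is the structure map ([comp_interleaves]).

    The substance is the contiguity theorem for oriented chains.  The usual prism
    [sum_i (-1)^i [f x_0, .., f x_i, g x_i, .., g x_n]] depends on the order of
    the vertices, so it is not defined on oriented chains unless the vertices are
    ordered.  Instead [f] is turned into [g] one vertex at a time.  When [f] and
    [f'] differ only at [v], there is a homotopy that needs no order: oriented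
    simplices behave as exterior monomials, [cone x] being the left product by
    [x], and with [contract v] the interior product that removes [v] the map
    [f v /\ f' v /\ f (contract v c)] is a homotopy from [f] to [f']
    ([homotopy_formula]).  A given cycle has finitely many vertices
    ([chains_finite_support]), so finitely many such steps suffice for it. *)

(** * Linearity of the cone *)

Section ConeLinear.
Context {k : fieldType} {X : choiceType} (x : X).
Implicit Types c d : Chain k X.

Lemma cone0 : cone x (0 : Chain k X) = 0. Proof. exact: linear0. Qed.

Lemma coneN c : cone x (- c) = - cone x c. Proof. exact: linearN. Qed.

Lemma coneD c d : cone x (c + d) = cone x c + cone x d.
Proof. exact: linearD. Qed.

Lemma coneB c d : cone x (c - d) = cone x c - cone x d.
Proof. exact: linearB. Qed.

End ConeLinear.

(** * Interior product of oriented chains by a vertex *)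

Section Contract.
Context {k : fieldType} {X : choiceType} (v : X).

(** The sign of the term that removes [v] is the parity of its position; it comes
    from moving [v] to the front. *)
Fixpoint contract_osimp (s : seq X) : Chain k X :=
  if s is x :: s' then
    (if x == v then osimp k s' else 0) - cone x (contract_osimp s')
  else 0.

Lemma contract_osimp_swap s1 x y s2 :
  contract_osimp (s1 ++ x :: y :: s2) = - contract_osimp (s1 ++ y :: x :: s2).
Proof.
elim: s1 => [|z s1 IH] /=.
  rewrite !coneB coneC [cone x (if _ then _ else _)]fun_if.
  rewrite [cone y (if _ then _ else _)]fun_if !cone0 !coneE.
  by rewrite opprK opprB opprD [in LHS]addrCA [in LHS]addrC.
rewrite IH osimp_swap linearN opprB opprK addrC.
by case: ifP => _; rewrite ?subr0 ?addr0 ?add0r.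
Qed.

(** The interior product is an antiderivation, and [cone x] kills [osimp s]
    when [x] is a vertex of [s]; only the term that removes [x] survives. *)
Lemma cone_contract_osimp x s : x \in s ->
  cone x (contract_osimp s) = if x == v then osimp k s else 0.
Proof.
elim: s => // y s IH; rewrite inE /= linearB /= [cone x (if _ then _ else _)]fun_if.
rewrite linear0 coneE; have [->|_ /= xs] := eqVneq x y; first by rewrite cone2 subr0.
rewrite coneC opprK IH // osimp_degen ?if_same ?add0r /= ?xs //.
by case: ifP; rewrite ?linear0 ?coneE.
Qed.

Lemma contract_osimp_degen s : ~~ uniq s -> contract_osimp s = 0.
Proof.
elim: s => //= x s IH; rewrite negb_and negbK => /orP[xs|us].
  by rewrite cone_contract_osimp // subrr.
by rewrite IH // linear0 subr0 osimp_degen ?if_same.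
Qed.

Definition contract : Chain k X -> Chain k X :=
  chain_lift contract_osimp_degen contract_osimp_swap.

HB.instance Definition _ := GRing.Linear.on contract.

Lemma contractE s : contract (osimp k s) = contract_osimp s.
Proof. exact: chain_liftE. Qed.

Lemma contract_cons x s :
  contract (osimp k (x :: s)) =
  (if x == v then osimp k s else 0) - cone x (contract (osimp k s)).
Proof. by rewrite !contractE. Qed.

Lemma contract_cone x c :
  contract (cone x c) = (if x == v then c else 0) - cone x (contract c).
Proof.
case: ifP => xv.
  apply: (chain_ext (f := contract \o cone x) (g := idfun \- (cone x \o contract))).
  by move=> s /=; rewrite coneE contract_cons xv.
rewrite sub0r.
apply: (chain_ext (f := contract \o cone x) (g := \- (cone x \o contract))).
by move=> s /=; rewrite coneE contract_cons xv sub0r.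
Qed.

(** Two interior products anticommute: [aug] is the one by the linear form that
    is [1] on every vertex. *)
Lemma contract_aug c : contract (aug c) = - aug (contract c).
Proof.
apply: (chain_ext (f := contract \o @aug k X) (g := \- (@aug k X \o contract))) => s /=.
elim: s => [|x s IH].
  by rewrite contractE augE /faces big_ord0 !linear0.
rewrite augE faces_cons -augE linearB /= contract_cone IH contract_cons.
rewrite [aug (_ - _)]linearB /= aug_cone linearN /= [aug (if _ then _ else _)]fun_if.
by rewrite linear0 opprK opprB opprD [in LHS]addrCA [in LHS]addrC.
Qed.

(** A term of the contraction is a face opposite to [v], so nothing survives
    unless [v] is a vertex. *)
Lemma contract_osimp_span s :
  contract_osimp s \in
    Defs.span [set osimp k t | t in [set t | {subset v :: t <= s}]].
Proof.
elim: s => [|x s IH] /=; first exact: rpred0.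
rewrite rpredB //.
  case: eqVneq => [->|_]; last exact: rpred0.
  by apply: mem_span; exists s.
move: IH; apply: span_preim => _ [t ts <-] /=; rewrite coneE.
apply: mem_span; exists (x :: t) => //= y; rewrite !inE => /or3P[/eqP->|->//|yt].
  by rewrite ts ?orbT // mem_head.
by rewrite ts ?orbT // inE yt orbT.
Qed.

End Contract.

(** * The homotopy between two maps that differ at one vertex *)

Lemma push_cone (k : fieldType) (X Y : choiceType) (f : X -> Y) x c :
  push k f (cone x c) = cone (f x) (push k f c).
Proof.
apply: (chain_ext (f := push k f \o cone x) (g := cone (f x) \o push k f)) => s /=.
by rewrite coneE !pushE coneE.
Qed.

Lemma push_aug (k : fieldType) (X Y : choiceType) (f : X -> Y) c :
  push k f (aug c) = aug (push k f c).
Proof.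
apply: (chain_ext (f := push k f \o @aug k X) (g := @aug k Y \o push k f)) => s /=.
rewrite pushE !augE /faces size_map linear_sum; apply: eq_bigr => i _.
by rewrite linearZ /= pushE /face map_cat map_take map_drop.
Qed.

Lemma bd_cone_cone (k : fieldType) (X : choiceType) (x y : X) (c : Chain k X) :
  bd (cone x (cone y c)) = aug (cone x (cone y c)).
Proof.
apply: (chain_ext (f := bd \o (cone x \o cone y)) (g := @aug k X \o (cone x \o cone y))).
by move=> s /=; rewrite !coneE bdE bd_osimpE augE.
Qed.

(** [bd] and [aug] differ only on vertices, where [aug] gives the class of the
    empty sequence; its contraction vanishes. *)
Lemma contract_bd (k : fieldType) (X : choiceType) (v : X) (c : Chain k X) :
  contract v (bd c) = contract v (aug c).
Proof.
apply: (chain_ext (f := contract v \o bd) (g := contract v \o @aug k X)) => s /=.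
rewrite bdE bd_osimpE augE; case: s => [|x [|y s]] //=.
  by rewrite /faces big_ord0.
rewrite linear0 faces_cons linearB /= contractE /faces big_ord0.
by rewrite /= !linear0 addr0.
Qed.

Section Homotopy.
Context {k : fieldType} {X Y : choiceType} {f f' : X -> Y} (v : X).
Context (eq_off : forall x, x != v -> f' x = f x).

Definition homotopy (c : Chain k X) : Chain k Y :=
  cone (f v) (cone (f' v) (push k f (contract v c))).

(** The decomposition of [c] into [v /\ contract v c] and a part without [v],
    on which [f] and [f'] agree. *)
Lemma push_sub c : push k f' c - push k f c =
  cone (f' v) (push k f (contract v c)) - cone (f v) (push k f (contract v c)).
Proof.
apply: (chain_ext (f := push k f' \- push k f)
  (g := (cone (f' v) \o (push k f \o contract v)) \-
        (cone (f v) \o (push k f \o contract v)))) => /= s.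
elim: s => [|x s IH]; first by rewrite !pushE contractE /= !linear0 subrr addr0.
have E g : push k g (osimp k (x :: s)) = cone (g x) (push k g (osimp k s)).
  by rewrite -coneE push_cone.
rewrite contract_cons !E linearB /= push_cone.
move/eqP: IH; rewrite subr_eq => /eqP->.
have [->|xv] := eqVneq x v.
  rewrite !coneB coneD coneB !cone2.
  by rewrite sub0r subr0 [- _ + _]addrC.
rewrite (eq_off _ xv) linear0 !sub0r coneD coneB addrK !coneN.
by rewrite ![cone (f x) (cone _ _)]coneC.
Qed.

Lemma homotopy_formula c :
  push k f' c - push k f c = bd (homotopy c) + homotopy (bd c).
Proof.
rewrite push_sub /homotopy bd_cone_cone contract_bd contract_aug !aug_cone.
by rewrite coneB [push k f (- _)]linearN /= !coneN push_aug opprB addrA addrAC addrK.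
Qed.

End Homotopy.

(** * Contiguous maps induce the same map in homology *)

Definition contiguous {X Y : choiceType} (K : complex X) (L : complex Y)
    (f g : X -> Y) : Prop :=
  forall sigma : {fset X}, K sigma ->
    L ([fset f x | x in sigma] `|` [fset g x | x in sigma])%fset.

Section OneVertex.
Context {k : fieldType} {X Y : choiceType} {K : complex X} {L : complex Y}.
Context {f f' : X -> Y} (v : X).
Context (ff' : contiguous K L f f').

Lemma homotopy_chains :
  {in chains k K, forall c, homotopy (f := f) (f' := f') v c \in chains k L}.
Proof.
apply: (span_preim (f := cone (f v) \o (cone (f' v) \o (push k f \o contract v)))).
move=> _ [s sK <-] /=; rewrite contractE.
move: (contract_osimp_span (k := k) v s).
apply: (span_preim (f := cone (f v) \o (cone (f' v) \o push k f))).
move=> _ [t ts <-] /=; rewrite pushE !coneE.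
apply: mem_span; exists [:: f v, f' v & map f t] => //=.
have vs : v \in s by apply: ts; rewrite mem_head.
apply: simplex_sub (ff' _ sK) _ _; last first.
  by apply/fset0Pn; exists (f v); rewrite !inE eqxx.
apply/fsubsetP => y; rewrite !inE => /or3P[/eqP->|/eqP->|/mapP[x xt ->]].
- by apply/orP; left; apply/imfsetP; exists v; rewrite ?inE.
- by apply/orP; right; apply/imfsetP; exists v; rewrite ?inE.
apply/orP; left; apply/imfsetP; exists x => //.
by rewrite inE ts // inE xt orbT.
Qed.

End OneVertex.

(** The subspaces of chains with vertices in [F] are directed, so their union is
    a subspace. *)
Lemma chains_finite_support {k : fieldType} {X : choiceType} {K : complex X} {c} :
  c \in chains k K ->
  exists F : seq X, c \in Defs.span [set osimp k s | s in [set s | {subset s <= F}]].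
Proof.
pose W := [set c : Chain k X | exists F : seq X,
  c \in Defs.span [set osimp k s | s in [set s | {subset s <= F}]]].
have mono (F G : seq X) : {subset F <= G} ->
    {subset Defs.span [set osimp k s | s in [set s | {subset s <= F}]] <=
            Defs.span [set osimp k s | s in [set s | {subset s <= G}]]}.
  move=> FG; apply: span_ind => _ [s sF <-]; apply: mem_span; exists s => //=.
  by move=> x /sF/FG.
have hW : subspace_axiom W.
  split=> [|a x y [F xF] [G yG]]; first by exists [::]; exact: rpred0.
  exists (F ++ G); rewrite rpredD ?rpredZ //.
    by apply: mono xF => z zF; rewrite mem_cat zF.
  by apply: mono yG => z zG; rewrite mem_cat zG orbT.
move=> cK; apply/(subspaceP hW); apply: (span_ind _ cK) => _ [s _ <-].
by apply/subspaceP; exists s; apply: mem_span; exists s.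
Qed.

Section Contiguity.
Context {k : fieldType} {X Y : choiceType} {K : complex X} {L : complex Y}.
Context {f g : X -> Y} (fg : contiguous K L f g).

Definition patch (F : seq X) (x : X) : Y := if x \in F then g x else f x.

(** A patch takes each vertex where [f] or [g] takes it, so all patches stay in
    the common simplices of [f] and [g]. *)
Lemma contiguous_patch F G : contiguous K L (patch F) (patch G).
Proof.
move=> sigma sK; apply: simplex_sub (fg _ sK) _ _; last first.
  have /fset0Pn[x xs] := simplex_neq0 sK.
  by apply/fset0Pn; exists (patch F x); rewrite inE in_imfset.
have patch_in H x : x \in sigma ->
    patch H x \in ([fset f x | x in sigma] `|` [fset g x | x in sigma])%fset.
  by move=> xs; rewrite /patch inE; case: ifP => _; rewrite in_imfset ?orbT.
by apply/fsubsetP => y; rewrite inE => /orP[] /imfsetP[x /= xs ->]; exact: patch_in.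
Qed.

(** Each vertex of [F] in turn is moved from [f] to [g]; the homotopies add up
    because [c] is a cycle. *)
Lemma patch_homologous F c : c \in cycles k K ->
  exists2 d, d \in chains k L & bd d = push k (patch F) c - push k f c.
Proof.
move=> /subspaceP[cK c0]; elim: F => [|v F [d dL dE]].
  exists 0; first exact: rpred0.
  by rewrite linear0 (_ : patch [::] = f) ?subrr.
exists (homotopy (f := patch F) (f' := patch (v :: F)) v c + d).
  rewrite rpredD //.
  exact: (homotopy_chains v (contiguous_patch F (v :: F)) _ cK).
have eq_off x : x != v -> patch (v :: F) x = patch F x.
  by rewrite /patch inE => /negPf->.
have := homotopy_formula v eq_off c.
rewrite c0 /homotopy [contract v 0]linear0 [push k _ 0]linear0 !cone0 addr0 => bdh.
by rewrite [bd (_ + _)]linearD /= dE -bdh addrA subrK.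
Qed.

Lemma contiguous_homologous c : c \in cycles k K ->
  exists2 d, d \in chains k L & bd d = push k g c - push k f c.
Proof.
move=> cZ; have /subspaceP[cK _] := cZ; have [F cF] := chains_finite_support cK.
have [d dL dE] := patch_homologous F _ cZ; exists d => //; rewrite dE; congr (_ - _).
apply: (span_eq (f := push k (patch F)) (g := push k g) _ cF) => _ [s sF <-] /=.
by rewrite !pushE; congr osimp; apply/eq_in_map => x xs; rewrite /patch sF.
Qed.

Theorem contiguous_homology_map (hf : simplicial K L f) (hg : simplicial K L g) :
  homology_map k hf =1 homology_map k hg.
Proof.
elim/homology_ind => z; rewrite !homology_mapE; apply/esym/eqP; rewrite qpi_eq.
apply/subspaceP; have [d dL dE] := contiguous_homologous _ (valP z).
by exists d.
Qed.

End Contiguity.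

(** * Homology of multivalued maps *)

Section Multivalued.
Context {R : realType} (k : fieldType) {X Y : choiceType}.
Context {S : filtered_complex R X} {T : filtered_complex R Y} {eps : R}.

(** Two such maps are contiguous because the image of a simplex under both lies
    in its image under [C]. *)
Lemma subordinate_phomology_map (C : set (X * Y)) (sC : eps_simplicial eps S T C)
    (f g : X -> Y) (hf : subordinate f C) (hg : subordinate g C) :
  phomology_map k (subordinate_simplicial sC hf) =
  phomology_map k (subordinate_simplicial sC hg).
Proof.
apply: phom_ext => a; apply: contiguous_homology_map => sigma sS.
apply: (sC a sigma) => //.
  have /fset0Pn[x xs] := simplex_neq0 sS.
  by apply/fset0Pn; exists (f x); rewrite inE in_imfset.
by move=> y /=; rewrite inE => /orP[] /imfsetP[x /= xs ->]; exists x.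
Qed.

(** Both [x] and [g (f x)] lie in the image of [f x] under [D], so [D] puts the
    image of [sigma] and [sigma] itself into one simplex. *)
Lemma comp_interleaves (delta : R) (D : set (Y * X))
    (sD : eps_simplicial delta T S D) (f : X -> Y) (g : Y -> X)
    (hf : forall a, simplicial (S a) (T (a + eps)) f)
    (hg : subordinate g D) (fD : forall x, D (f x, x))
    (ge0 : 0 <= eps + delta) :
  phom_comp (phomology_map k (subordinate_simplicial sD hg)) (phomology_map k hf) =
  pshift (phomology k S) ge0.
Proof.
apply: phom_ext => a u /=.
have hgf : simplicial (S a) (S (a + eps + delta)) (g \o f).
  by apply: simplicial_comp (hf a) _; exact: (subordinate_simplicial sD hg).
have hgf' : simplicial (S a) (S (a + (eps + delta))) (g \o f) by rewrite addrA.
rewrite (homology_map_comp _ _ hgf) (homology_map_comp (g := id) _ _ hgf').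
apply: contiguous_homology_map => sigma sS; rewrite addrA.
apply: (sD _ _ _ (hf a _ sS)).
  have /fset0Pn[x xs] := simplex_neq0 sS.
  by apply/fset0Pn; exists (g (f x)); rewrite inE (in_imfset _ (g \o f)).
move=> y /=; rewrite inE => /orP[] /imfsetP[x /= xs ->];
  by exists (f x) => //=; rewrite in_imfset.
Qed.

End Multivalued.

Theorem proposition4p2 (k : fieldType) (R : realType) (X Y : choiceType)
    (S : filtered_complex R X) (T : filtered_complex R Y)
    (eps : R) (eps_ge0 : 0 <= eps)
    (C : set (X * Y)) (hC : correspondence C)
    (sC : eps_simplicial eps S T C)
    (sCT : eps_simplicial eps T S (transpose C)) :
  let HC : phom eps (phomology k S) (phomology k T) :=
    phomology_multi k (proj1 hC) sC in
  let HCT : phom eps (phomology k T) (phomology k S) :=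
    phomology_multi k (proj2 hC) sCT in
  [/\ forall (f : X -> Y) (hf : subordinate f C),
         phomology_map k (subordinate_simplicial sC hf) = HC,
      forall (g : Y -> X) (hg : subordinate g (transpose C)),
         phomology_map k (subordinate_simplicial sCT hg) = HCT
    & interleaving eps_ge0 HC HCT].
Proof.
split=> [f hf|g hg|]; [exact: subordinate_phomology_map..|split].
  by apply: comp_interleaves; exact: (selection_subordinate (proj1 hC)).
by apply: comp_interleaves; exact: (selection_subordinate (proj2 hC)).
Qed.
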